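(* Let $(T^*Q,G,\omega,H,F,W)$ be a regular point reducible RCH system with an $R_p$-reduced RCH system $((T^*Q)_\mu,\omega_\mu,h_\mu,f_\mu,u_\mu)$, where $\mu\in\mathfrak g^*$ is a regular value of the momentum map $\mathbf J$. Let $\tilde X=X_{(T^*Q,G,\omega,H,F,u)}$ be the dynamical vector field of $(T^*Q,G,\omega,H,F,W)$ with a control law $u$. Let $\gamma:Q\to T^*Q$ be a one-form on $Q$, $\lambda=\gamma\circ\pi_Q:T^*Q\to T^*Q$, and for any symplectic map $\varepsilon:T^*Q\to T^*Q$ denote $\tilde X^\varepsilon=T\pi_Q\circ\tilde X\circ\varepsilon$. Assume that $\mathrm{Im}(\gamma)\subset\mathbf J^{-1}(\mu)$ and $\gamma$ is $G_\mu$-invariant, and that $\varepsilon$ is $G_\mu$-invariant and $\varepsilon(\mathbf J^{-1}(\mu))\subset\mathbf J^{-1}(\mu)$. Denote $\bar\gamma=\pi_\mu\circ\gamma:Q\to(T^*Q)_\mu$, $\bar\lambda=\pi_\mu\circ\lambda:\mathbf J^{-1}(\mu)\,(\subset T^*Q)\to(T^*Q)_\mu$ and $\bar\varepsilon=\pi_\mu\circ\varepsilon:\mathbf J^{-1}(\mu)\,(\subset T^*Q)\to(T^*Q)_\mu$. Then $\varepsilon$ and $\bar\varepsilon$ satisfy the equation $$T\bar\varepsilon\circ X_{h_\mu\circ\bar\varepsilon}=T\bar\lambda\circ\tilde X\circ\varepsilon$$ if and only if they satisfy the equation $$T\bar\gamma\circ\tilde X^\varepsilon=X_{h_\mu}\circ\bar\varepsilon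 ,$$ where $X_{h_\mu}$ and $X_{h_\mu\circ\bar\varepsilon}$ are the Hamiltonian vector fields of $h_\mu$ and $h_\mu\circ\bar\varepsilon$, respectively. (The latter equation is called the Type II of Hamilton-Jacobi equation for the $R_p$-reduced RCH system.)
   Context: All manifolds and maps are smooth and finite dimensional. $\pi_Q:T^*Q\to Q$ is the projection, $\omega=-\mathbf d\theta$ the canonical symplectic form on $T^*Q$; Hamiltonian vector fields are defined by $\mathbf i_{X_K}\omega=\mathbf dK$. A one-form is a section $\gamma:Q\to T^*Q$. RCH systems: on a symplectic fiber bundle $(E,\omega_E)$, $\pi:E\to M$, an RCH system is a 5-tuple $(E,\omega_E,H,F,W)$ with $H:E\to\mathbb R$, $F:E\to E$ fiber-preserving (external force), $W\subset E$ a fiber submanifold (control subset); a control law is a fiber-preserving $u:E\to W$. Fix a metric on $E$ giving $TE=HE\oplus VE$, $VE=\ker T\pi$. $\mathrm{vlift}(F)X_H(a_x)$, $a_x\in E_x$, is the vertical part of $TF(X_H(a_x))$ (a vector at $F(a_x)$), parallel-translated to $a_x$ along a geodesic in $E_x$ from $F(a_x)$ to $a_x$ (a straight line if the fibers are vector spaces); one writes $\mathrm{vlift}(F)$ for $\mathrm{vlift}(F)X_H$, likewise $\mathrm{vlift}(u)$. The dynamical vector field is $X_H+\mathrm{vlift}(F)+\mathrm{vlift}(u)$. Reduction: a Lie group $G$ with Lie algebra $\mathfrak g$ acts on $Q$ on the left, freely and properly; the cotangent lifted action $\Phi^{T^*}$ on $T^*Q$ is symplectic, free and proper and has an $\mathrm{Ad}^*$-equivariant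 momentum map $\mathbf J:T^*Q\to\mathfrak g^*$. For a regular value $\mu$, $G_\mu=\{g\in G\mid \mathrm{Ad}_g^*\mu=\mu\}$, $(T^*Q)_\mu=\mathbf J^{-1}(\mu)/G_\mu$, $i_\mu:\mathbf J^{-1}(\mu)\to T^*Q$ the inclusion, $\pi_\mu:\mathbf J^{-1}(\mu)\to(T^*Q)_\mu$ the projection, and the symplectic form $\omega_\mu$ is determined by $\pi_\mu^*\omega_\mu=i_\mu^*\omega$. A regular point reducible RCH system is a 6-tuple $(T^*Q,G,\omega,H,F,W)$ with $H$, $F$, $W$ all $G$-invariant (for maps of $T^*Q$, invariant means commuting with the action), such that for some regular value $\mu$ of $\mathbf J$ one has $F(\mathbf J^{-1}(\mu))\subset\mathbf J^{-1}(\mu)$, $W\cap\mathbf J^{-1}(\mu)\neq\emptyset$, and the $R_p$-reduced 5-tuple $((T^*Q)_\mu,\omega_\mu,h_\mu,f_\mu,W_\mu)$ is an RCH system, where $h_\mu\circ\pi_\mu=H\circ i_\mu$, $f_\mu\circ\pi_\mu=\pi_\mu\circ F\circ i_\mu$, $W_\mu=\pi_\mu(W\cap\mathbf J^{-1}(\mu))$. The dynamical vector field with control law $u$ is $X_{(T^*Q,G,\omega,H,F,u)}=X_H+\mathrm{vlift}(F)+\mathrm{vlift}(u)$; a reduced control law $u_\mu:(T^*Q)_\mu\to W_\mu$ gives $X_{((T^*Q)_\mu,\omega_\mu,h_\mu,f_\mu,u_\mu)}=X_{h_\mu}+\mathrm{vlift}(f_\mu)+\mathrm{vlift}(u_\mu)$,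 assumed to satisfy $X_{((T^*Q)_\mu,\omega_\mu,h_\mu,f_\mu,u_\mu)}\circ\pi_\mu=T\pi_\mu\circ X_{(T^*Q,G,\omega,H,F,u)}\circ i_\mu$. A one-form $\gamma$ is $G_\mu$-invariant if $\gamma(g\cdot q)=\Phi^{T^*}_g(\gamma(q))$ for $g\in G_\mu$. The map $\varepsilon$ is $G_\mu$-invariant if $\varepsilon\circ\Phi^{T^*}_g=\Phi^{T^*}_g\circ\varepsilon$ for $g\in G_\mu$. The function $h_\mu\circ\bar\varepsilon$ on $\mathbf J^{-1}(\mu)$ equals $(H\circ\varepsilon)|_{\mathbf J^{-1}(\mu)}$ and is regarded as a function on $T^*Q$ through its extension $H\circ\varepsilon$, so $X_{h_\mu\circ\bar\varepsilon}$ is the Hamiltonian vector field of $H\circ\varepsilon$ with respect to $\omega$, taken along $\mathbf J^{-1}(\mu)$. The two equations are equations of maps on $\mathbf J^{-1}(\mu)$. *)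

(* Defs.v *)
From mathcomp Require Import all_boot all_order all_algebra.
From mathcomp Require Import all_classical all_reals all_analysis.
Set Implicit Arguments.
Unset Strict Implicit.
Unset Printing Implicit Defensive.
Import Order.TTheory GRing.Theory Num.Theory.
Import numFieldNormedType.Exports.
Local Open Scope classical_set_scope.
Local Open Scope ring_scope.

(** Vectors and covectors are rows; a linear map is a matrix acting on the right
    of a vector, and a bilinear form is its Gram matrix. *)
Definition pairing (R : realType) n (a v : 'rV[R]_n) : R := (v *m a^T) 0 0.
Definition bil (R : realType) n (A : 'M[R]_n) (v w : 'rV[R]_n) : R :=
  (v *m A *m w^T) 0 0.

(** [Ck_at k f x]: f is of class C^k on a neighbourhood of x.  The spaces are
    only ever finite dimensional, so continuity of all y |-> 'd f y v is
    continuity of the derivative. *)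
Fixpoint Ck_at (R : realType) (k : nat) (U V : normedModType R)
    (f : U -> V) (x : U) : Prop :=
  match k with
  | 0 => \forall y \near x, {for y, continuous f}
  | k'.+1 => (\forall y \near x, differentiable f y) /\
             (forall v : U, Ck_at k' (fun y => 'd f y v : V) x)
  end.

Definition Cinf_at (R : realType) (U V : normedModType R) (f : U -> V) (x : U) :=
  forall k, Ck_at k f x.

(** * Manifolds

    [chart x] is a chosen chart around [x], with inverse [chartV x]; both are
    meaningful on [cdom x] and on its image only.  The smooth structure is the
    one generated by the atlas of all [chart x]. *)
Record manifold (R : realType) (n : nat) := Manifold {
  msort :> topologicalType;
  cdom : msort -> set msort;
  chart : msort -> msort -> 'rV[R]_n;
  chartV : msort -> 'rV[R]_n -> msort;
  hausdorff_msort : hausdorff_space msort;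
  second_countable_msort : @second_countable msort;
  cdom_open : forall x, open (cdom x);
  cdom_center : forall x, cdom x x;
  cimage_open : forall x, open (chart x @` cdom x);
  chartK : forall x y, cdom x y -> chartV x (chart x y) = y;
  chart_cont : forall x y, cdom x y -> {for y, continuous (chart x)};
  chartV_cont : forall x y, cdom x y -> {for chart x y, continuous (chartV x)};
  chart_compat : forall x y z, cdom x z -> cdom y z ->
    Cinf_at (chart y \o chartV x) (chart x z)
}.

(** T_xM is represented by R^n through the differential at x of [chart x].
    [tmap f x] is the tangent map T_xM -> T_(f x)N and [mdiff f x] the
    differential at x of a vector-valued f. *)
Definition mdiff (R : realType) m (M : manifold R m) (V : normedModType R)
    (f : M -> V) (x : M) (v : 'rV[R]_m) : V :=
  'd (f \o chartV x) (chart x x) v.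

Definition tmap (R : realType) m n (M : manifold R m) (N : manifold R n)
    (f : M -> N) (x : M) : 'M[R]_(m, n) :=
  'J (chart (f x) \o f \o chartV x) (chart x x).

(** The change of coordinates from T_yM (that is, from [chart y]) to [chart x]. *)
Definition dchart (R : realType) m (M : manifold R m) (x y : M) : 'M[R]_m :=
  'J (chart x \o chartV y) (chart y y).

Definition smooth_fun_at (R : realType) m (M : manifold R m)
    (V : normedModType R) (f : M -> V) (x : M) :=
  Cinf_at (f \o chartV x) (chart x x).

Definition smooth_fun (R : realType) m (M : manifold R m)
    (V : normedModType R) (f : M -> V) := forall x, smooth_fun_at f x.

Definition smooth_at (R : realType) m n (M : manifold R m) (N : manifold R n)
    (f : M -> N) (x : M) :=
  {for x, continuous f} /\ smooth_fun_at (chart (f x) \o f) x.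

Definition smooth (R : realType) m n (M : manifold R m) (N : manifold R n)
    (f : M -> N) := forall x, smooth_at f x.

(** Joint smoothness, i.e. smoothness on the product manifold. *)
Definition smooth2_at (R : realType) m n p (M : manifold R m) (N : manifold R n)
    (P : manifold R p) (f : M -> N -> P) (x : M) (y : N) :=
  {for (x, y), continuous (fun a : M * N => f a.1 a.2)} /\
  Cinf_at (fun a : 'rV[R]_m * 'rV[R]_n =>
             chart (f x y) (f (chartV x a.1) (chartV y a.2)))
          (chart x x, chart y y).

Definition smooth2 (R : realType) m n p (M : manifold R m) (N : manifold R n)
    (P : manifold R p) (f : M -> N -> P) := forall x y, smooth2_at f x y.

Definition embedding (R : realType) m n (S : manifold R m) (M : manifold R n)
    (j : S -> M) : Prop :=
  [/\ smooth j, forall x, row_free (tmap j x), injective j &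
      forall U : set S, open U -> exists2 V : set M, open V & U = j @^-1` V].

Definition surjective_submersion (R : realType) m n (M : manifold R m)
    (N : manifold R n) (f : M -> N) : Prop :=
  [/\ smooth f, forall x, row_full (tmap f x) & forall y, exists x, f x = y].

(** * Tensor fields

    A one-form is given by its values a x in T_x^*M, a covariant 2-tensor by
    its Gram matrices on T_xM.  [form1_rep] and [form2_rep] are their
    components in the chart [chart x], as functions on the image of the chart. *)
Definition form1_rep (R : realType) m (M : manifold R m) (a : M -> 'rV[R]_m)
    (x : M) (v : 'rV[R]_m) : 'rV[R]_m :=
  let y := chartV x v in a y *m ('J (chart y \o chartV x) v)^T.

Definition form2_rep (R : realType) m (M : manifold R m) (b : M -> 'M[R]_m)
    (x : M) (v : 'rV[R]_m) : 'M[R]_m :=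
  let y := chartV x v in
  let D := 'J (chart y \o chartV x) v in D *m b y *m D^T.

(** (d a)_ij = d_i a_j - d_j a_i *)
Definition ext_d (R : realType) m (M : manifold R m) (a : M -> 'rV[R]_m)
    (x : M) : 'M[R]_m :=
  let A := 'J (form1_rep a x) (chart x x) in A - A^T.

Definition smooth_form2 (R : realType) m (M : manifold R m) (b : M -> 'M[R]_m) :=
  forall x, Cinf_at (form2_rep b x) (chart x x).

Definition closed_form2 (R : realType) m (M : manifold R m) (b : M -> 'M[R]_m) :=
  forall (x : M) (u v w : 'rV[R]_m),
    let D a := 'd (form2_rep b x) (chart x x) a in
    bil (D u) v w + bil (D v) w u + bil (D w) u v = 0.

Definition symplectic_form (R : realType) m (M : manifold R m)
    (omega : M -> 'M[R]_m) : Prop :=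
  [/\ smooth_form2 omega, forall x, (omega x)^T = - omega x,
      forall x, omega x \in unitmx & closed_form2 omega].

Definition riemannian_metric (R : realType) m (M : manifold R m)
    (g : M -> 'M[R]_m) : Prop :=
  [/\ smooth_form2 g, forall x, (g x)^T = g x &
      forall x v, v != 0 -> 0 < bil (g x) v v].

Definition pullback_form2 (R : realType) m n (M : manifold R m)
    (N : manifold R n) (f : M -> N) (b : N -> 'M[R]_n) (x : M) : 'M[R]_m :=
  tmap f x *m b (f x) *m (tmap f x)^T.

Definition symplectic_map (R : realType) m (M : manifold R m)
    (omega : M -> 'M[R]_m) (f : M -> M) : Prop :=
  smooth f /\ forall x, pullback_form2 f omega x = omega x.

Definition hamiltonian_vf (R : realType) m (M : manifold R m)
    (omega : M -> 'M[R]_m) (K : M -> R^o) (X : M -> 'rV[R]_m) : Prop :=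
  forall x w, bil (omega x) (X x) w = mdiff K x w.

Definition fiber_bundle (R : realType) m b (E : manifold R m) (B : manifold R b)
    (pr : E -> B) : Prop :=
  [/\ smooth pr, forall x, exists z, pr z = x &
      forall x, exists (U : set B) (d : nat) (Y : manifold R d)
                       (tau : E -> Y) (sigma : B -> Y -> E),
        [/\ open U, U x,
            forall z, U (pr z) -> smooth_at tau z /\ sigma (pr z) (tau z) = z &
            forall x' y, U x' ->
              [/\ smooth2_at sigma x' y, pr (sigma x' y) = x'
                & tau (sigma x' y) = y]]].

Definition fiber_preserving (T B : Type) (pr : T -> B) (f : T -> T) : Prop :=
  forall z, pr (f z) = pr z.

Definition fiber_submanifold (R : realType) m b (E : manifold R m)
    (B : manifold R b) (pr : E -> B) (W : set E) : Prop :=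
  exists (d : nat) (S : manifold R d) (j : S -> E),
    [/\ embedding j, range j = W & surjective_submersion (pr \o j)].

Definition vertical (R : realType) m b (E : manifold R m) (B : manifold R b)
    (pr : E -> B) (z : E) (v : 'rV[R]_m) : Prop := v *m tmap pr z = 0.

(** v' is the VE-part of v in TE = HE (+) VE, HE the g-orthogonal of VE. *)
Definition vertical_part (R : realType) m b (E : manifold R m)
    (B : manifold R b) (pr : E -> B) (g : E -> 'M[R]_m) (z : E)
    (v v' : 'rV[R]_m) : Prop :=
  vertical pr z v' /\ forall w, vertical pr z w -> bil (g z) (v - v') w = 0.

(** Christoffel symbols of the first kind of g at x, in the chart [chart x]. *)
Definition christoffel (R : realType) m (M : manifold R m) (g : M -> 'M[R]_m)
    (x : M) (u v w : 'rV[R]_m) : R :=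
  let D a := 'd (form2_rep g x) (chart x x) a in
  2^-1 * (bil (D u) v w + bil (D v) u w - bil (D w) u v).

Definition velocity (R : realType) m (M : manifold R m) (c : R -> M) (t : R)
  : 'rV[R]_m := derive1 (chart (c t) \o c) t.

(** V is a vertical field along the curve c in a fiber, parallel for the
    Levi-Civita connection of the metric induced by g on that fiber.  That
    connection is the tangential part of the Levi-Civita connection of g, so the
    condition is that g (nabla_c' V, w) = 0 for every vertical w. *)
Definition fiber_parallel (R : realType) m b (E : manifold R m)
    (B : manifold R b) (pr : E -> B) (g : E -> 'M[R]_m)
    (c : R -> E) (V : R -> 'rV[R]_m) : Prop :=
  forall t, 0 <= t <= 1 ->
    let Vrep := fun s => V s *m dchart (c t) (c s) in
    [/\ vertical pr (c t) (V t), derivable Vrep t 1 &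
        forall w, vertical pr (c t) w ->
          bil (g (c t)) (derive1 Vrep t) w
          + christoffel g (c t) (velocity c t) (V t) w = 0].

Definition fiber_geodesic (R : realType) m b (E : manifold R m)
    (B : manifold R b) (pr : E -> B) (g : E -> 'M[R]_m) (c : R -> E) : Prop :=
  (forall t, 0 <= t <= 1 ->
     [/\ {for t, continuous c}, Cinf_at (chart (c t) \o c : R^o -> _) t
       & pr (c t) = pr (c 0)]) /\
  fiber_parallel pr g c (velocity c).

(** Y = vlift(F)X.  This is a relation because the geodesic from F a to a need
    not be unique. *)
Definition vlift (R : realType) m b (E : manifold R m) (B : manifold R b)
    (pr : E -> B) (g : E -> 'M[R]_m) (F : E -> E) (X Y : E -> 'rV[R]_m) : Prop :=
  forall a, exists (c : R -> E) (V : R -> 'rV[R]_m),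
    [/\ fiber_geodesic pr g c, c 0 = F a /\ c 1 = a, fiber_parallel pr g c V,
        vertical_part pr g (F a) (X a *m tmap F a) (V 0) & V 1 = Y a].

(** * RCH systems

    A symplectic fiber bundle is a fiber bundle with a symplectic form on its
    total space. *)
Definition RCH_system (R : realType) m b (E : manifold R m) (B : manifold R b)
    (pr : E -> B) (omega : E -> 'M[R]_m) (H : E -> R^o) (F : E -> E)
    (W : set E) : Prop :=
  [/\ fiber_bundle pr /\ symplectic_form omega, smooth_fun H,
      smooth F /\ fiber_preserving pr F & fiber_submanifold pr W].

Definition control_law (R : realType) m b (E : manifold R m) (B : manifold R b)
    (pr : E -> B) (W : set E) (u : E -> E) : Prop :=
  [/\ smooth u, fiber_preserving pr u & forall z, W (u z)].

Definition dynamical_vf (R : realType) m b (E : manifold R m) (B : manifold R b)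
    (pr : E -> B) (g : E -> 'M[R]_m) (omega : E -> 'M[R]_m) (H : E -> R^o)
    (F u : E -> E) (X : E -> 'rV[R]_m) : Prop :=
  exists XH YF Yu : E -> 'rV[R]_m,
    [/\ hamiltonian_vf omega H XH, vlift pr g F XH YF, vlift pr g u XH Yu &
        forall z, X z = XH z + YF z + Yu z].

(** * The cotangent bundle

    A point of T^*Q is a base point [cbase z] with a covector [cfib z] in the
    dual of T_(cbase z) Q; the chart at z is the cotangent lift
    (q', a) |-> (phi q', a o (T_q' phi)^-1) of phi := chart (cbase z).  These
    conditions determine the manifold T^*Q, and T_zT^*Q = R^n x R^n with the
    vertical vectors last. *)
Record cotangent_bundle (R : realType) n (Q : manifold R n) := CotangentBundle {
  cotangent :> manifold R (n + n);
  cbase : cotangent -> Q;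
  cfib : cotangent -> 'rV[R]_n;
  covec : Q -> 'rV[R]_n -> cotangent;
  cbase_covec : forall q a, cbase (covec q a) = q;
  cfib_covec : forall q a, cfib (covec q a) = a;
  covecK : forall z, covec (cbase z) (cfib z) = z;
  cdom_cotangent : forall z z' : cotangent,
    cdom z z' <-> cdom (cbase z) (cbase z');
  chart_cotangent : forall z z' : cotangent, cdom z z' ->
    chart z z' =
    row_mx (chart (cbase z) (cbase z'))
      (cfib z' *m ('J (chart (cbase z') \o chartV (cbase z))
                      (chart (cbase z) (cbase z')))^T)
}.

Arguments cbase {R n Q} _ _.
Arguments cfib {R n Q} _ _.

(** theta_z (v) = z (T pi_Q v) *)
Definition liouville (R : realType) n (Q : manifold R n)
    (TQ : cotangent_bundle Q) (z : TQ) : 'rV[R]_(n + n) :=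
  cfib TQ z *m (tmap (cbase TQ) z)^T.

Definition canonical_form (R : realType) n (Q : manifold R n)
    (TQ : cotangent_bundle Q) (z : TQ) : 'M[R]_(n + n) :=
  - ext_d (@liouville _ _ _ TQ) z.
Arguments canonical_form {R n Q} TQ _.

(** The metric induced on each vector space T_q^*Q is a constant inner product,
    so that geodesics of the fibers are straight lines and parallel translation
    along them is translation of vectors. *)
Definition fiberwise_euclidean (R : realType) n (Q : manifold R n)
    (TQ : cotangent_bundle Q) (g : TQ -> 'M[R]_(n + n)) : Prop :=
  forall (z z' : TQ) (a b : 'rV[R]_n), cbase TQ z = cbase TQ z' ->
    bil (g z) (row_mx 0 a) (row_mx 0 b) = bil (g z') (row_mx 0 a) (row_mx 0 b).

Definition one_form (R : realType) n (Q : manifold R n)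
    (TQ : cotangent_bundle Q) (gamma : Q -> TQ) : Prop :=
  smooth gamma /\ forall q, cbase TQ (gamma q) = q.

Record lie_group (R : realType) k := LieGroup {
  lgroup :> manifold R k;
  gmul : lgroup -> lgroup -> lgroup;
  ginv : lgroup -> lgroup;
  gone : lgroup;
  gmulA : forall a b c, gmul a (gmul b c) = gmul (gmul a b) c;
  gmul1 : forall a, gmul a gone = a;
  g1mul : forall a, gmul gone a = a;
  gmulV : forall a, gmul a (ginv a) = gone;
  gVmul : forall a, gmul (ginv a) a = gone;
  gmul_smooth : smooth2 gmul;
  ginv_smooth : smooth ginv
}.

(** The Lie algebra is T_eG.  [Ad g] is T_e of conjugation by g, and Ad_g^* is
    the dual of Ad_g, so g |-> Ad^*_(g^-1) is the left coadjoint action. *)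
Definition Ad (R : realType) k (G : lie_group R k) (g : G) : 'M[R]_k :=
  tmap (fun h => gmul (gmul g h) (ginv g)) (gone G).

Definition Adstar (R : realType) k (G : lie_group R k) (g : G)
    (mu : 'rV[R]_k) : 'rV[R]_k := mu *m (Ad g)^T.

Definition coadjoint_isotropy (R : realType) k (G : lie_group R k)
    (mu : 'rV[R]_k) : set G := [set g | Adstar g mu = mu].

Definition smooth_action (R : realType) k n (G : lie_group R k)
    (Q : manifold R n) (act : G -> Q -> Q) : Prop :=
  [/\ smooth2 act, forall q, act (gone G) q = q &
      forall g h q, act (gmul g h) q = act g (act h q)].

Definition free_action (R : realType) k n (G : lie_group R k)
    (Q : manifold R n) (act : G -> Q -> Q) : Prop :=
  forall g q, act g q = q -> g = gone G.

Definition proper_action (R : realType) k n (G : lie_group R k)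
    (Q : manifold R n) (act : G -> Q -> Q) : Prop :=
  forall K : set (Q * Q), compact K ->
    compact [set a : G * Q | K (act a.1 a.2, a.2)].

(** Phi^(T* )_g z = z o T Phi_(g^-1), a covector at g . cbase z *)
Definition cotangent_lift (R : realType) k n (G : lie_group R k)
    (Q : manifold R n) (TQ : cotangent_bundle Q) (act : G -> Q -> Q)
    (g : G) (z : TQ) : TQ :=
  covec TQ (act g (cbase TQ z))
    (cfib TQ z *m (tmap (act (ginv g)) (act g (cbase TQ z)))^T).

(** J is an Ad^*-equivariant momentum map of the cotangent lifted action:
    i_(xi_(T^*Q)) omega = d <J, xi>. *)
Definition momentum_map (R : realType) k n (G : lie_group R k)
    (Q : manifold R n) (TQ : cotangent_bundle Q) (act : G -> Q -> Q)
    (J : TQ -> 'rV[R]_k) : Prop :=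
  [/\ smooth_fun J,
      forall (xi : 'rV[R]_k) (z : TQ) (v : 'rV[R]_(n + n)),
        bil (canonical_form TQ z)
            (xi *m tmap (fun g => cotangent_lift act g z) (gone G)) v
        = pairing (mdiff J z v) xi &
      forall (g : G) (z : TQ),
        J (cotangent_lift act g z) = Adstar (ginv g) (J z)].

Definition regular_value (R : realType) m k (M : manifold R m)
    (J : M -> 'rV[R]_k) (mu : 'rV[R]_k) : Prop :=
  forall z, J z = mu -> forall y, exists v, mdiff J z v = y.

(** * Symplectic point reduction

    [level] is J^-1(mu) as an embedded submanifold, with inclusion i_mu;
    [reduced] is J^-1(mu)/G_mu with the smooth structure for which pi_mu is a
    surjective submersion.  Both are determined up to diffeomorphism. *)
Record point_reduction (R : realType) k n (G : lie_group R k)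
    (Q : manifold R n) (TQ : cotangent_bundle Q) (act : G -> Q -> Q)
    (J : TQ -> 'rV[R]_k) (mu : 'rV[R]_k) := PointReduction {
  level : manifold R (n + n - k);
  level_incl : level -> TQ;
  red_dim : nat;
  reduced : manifold R red_dim;
  red_proj : level -> reduced;
  red_form : reduced -> 'M[R]_red_dim;
  level_incl_embedding : embedding level_incl;
  range_level_incl : range level_incl = [set z | J z = mu];
  red_proj_submersion : surjective_submersion red_proj;
  red_proj_orbit : forall p p', red_proj p = red_proj p' <->
    exists2 g, coadjoint_isotropy mu g
      & level_incl p' = cotangent_lift act g (level_incl p);
  red_form_pullback : forall p,
    pullback_form2 red_proj red_form p
    = pullback_form2 level_incl (canonical_form TQ) p
}.

Arguments level_incl {R k n G Q TQ act J mu} _ _.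
Arguments red_proj {R k n G Q TQ act J mu} _ _.
Arguments red_form {R k n G Q TQ act J mu} _ _.

(** fbar = pi_mu o f, for a map f with values in J^-1(mu). *)
Definition reduces_to (T P M X : Type) (incl : P -> T) (proj : P -> M)
    (f : X -> T) (fbar : X -> M) : Prop :=
  forall x p, incl p = f x -> fbar x = proj p.

(** The vector v at [incl p], tangent to the submanifold P, is mapped to w by
    the tangent map at p of f : P -> N. *)
Definition tangent_image (R : realType) m p d (M : manifold R m)
    (P : manifold R p) (N : manifold R d) (incl : P -> M) (f : P -> N) (x : P)
    (v : 'rV[R]_m) (w : 'rV[R]_d) : Prop :=
  exists2 t, t *m tmap incl x = v & t *m tmap f x = w.

(** (T^*Q, G, omega, H, F, W) is a regular point reducible RCH system, reduced
    at mu to ((T^*Q)_mu, omega_mu, hmu, fmu, W_mu); rho is the fiber bundle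
    projection of (T^*Q)_mu. *)
Record regular_point_reducible (R : realType) k n (G : lie_group R k)
    (Q : manifold R n) (TQ : cotangent_bundle Q) (act : G -> Q -> Q)
    (J : TQ -> 'rV[R]_k) (mu : 'rV[R]_k) (red : point_reduction act J mu)
    (b : nat) (B : manifold R b) (rho : reduced red -> B)
    (H : TQ -> R^o) (F : TQ -> TQ) (W : set TQ)
    (hmu : reduced red -> R^o) (fmu : reduced red -> reduced red) : Prop :=
  RegularPointReducible {
  rpr_action : [/\ smooth_action act, free_action act & proper_action act];
  rpr_momentum : momentum_map act J;
  rpr_regular : regular_value J mu;
  rpr_RCH : RCH_system (cbase TQ) (canonical_form TQ) H F W;
  rpr_H : forall g z, H (cotangent_lift act g z) = H z;
  rpr_F : forall g z, F (cotangent_lift act g z) = cotangent_lift act g (F z);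
  rpr_W : forall g z, W z -> W (cotangent_lift act g z);
  rpr_F_level : forall z, J z = mu -> J (F z) = mu;
  rpr_W_level : exists2 z, W z & J z = mu;
  rpr_hmu : forall p, hmu (red_proj red p) = H (level_incl red p);
  rpr_fmu : reduces_to (level_incl red) (red_proj red)
              (F \o level_incl red)
              (fmu \o red_proj red);
  rpr_reduced_RCH :
    RCH_system rho (red_form red) hmu fmu
      (red_proj red @` (level_incl red @^-1` W))
}.

(* Main.v *)
Require Import Defs.
From mathcomp Require Import all_boot all_order all_algebra.
From mathcomp Require Import all_classical all_reals all_analysis.
From mathcomp Require Import lra.

Set Implicit Arguments.
Unset Strict Implicit.
Unset Printing Implicit Defensive.
Import Order.TTheory GRing.Theory Num.Theory.
Import numFieldNormedType.Exports.
Local Open Scope classical_set_scope.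
Local Open Scope ring_scope.

(** On P = J^-1(mu) the map eps restricts to a map e : P -> P, differentiable
    because the inclusion i is an embedding; as eps is symplectic, T eps is
    invertible, hence so is T e.  By Noether's theorem X_H is tangent to P, and
    T pi_mu sends it to X_(h_mu).  Since T eps o X_(H o eps) = X_H o eps, the
    field X_(H o eps) is tangent to P as well and
    T epsbar o X_(H o eps) = X_(h_mu) o epsbar.  On the other hand lambdabar is
    gammabar o pi_Q o i, so the right-hand side of the first equation is
    T gammabar o T pi_Q o Xt o eps: the two equations are the same. *)

(** * Differentials in normed spaces *)

Lemma is_diff_near (R : realType) (U V : normedModType R) (f : U -> V)
    (df : {linear U -> V}) (x : U) :
  continuous df ->
  (forall e, 0 < e ->
     \forall y \near x, `|f y - f x - df (y - x)| <= e * `|y - x|) ->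
  is_diff x f df.
Proof.
move=> dfc fe.
have E : f \o shift x = cst (f x) + df +o_ 0 id.
  apply/eqaddoP => e e0; have := fe e e0.
  rewrite (near_shift 0 x); apply: filterS => h /=.
  by rewrite subr0 addrK !fctE /= opprD addrA.
have D := diff_unique dfc E.
by apply: DiffDef => //; apply/diff_locallyP; rewrite D.
Qed.

Lemma diff_near (R : realType) (U V : normedModType R) (f : U -> V) (x : U) :
  differentiable f x -> forall e, 0 < e ->
     \forall y \near x, `|f y - f x - 'd f x (y - x)| <= e * `|y - x|.
Proof.
move=> /diff_locally/eqaddoP fo e /fo.
rewrite (near_shift 0 x); apply: filterS => h /=.
by rewrite !fctE /= subr0 addrK opprD addrA.
Qed.

Lemma near_eq_is_diff (R : realType) (U V : normedModType R) (f g : U -> V)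
    (x : U) : (\forall y \near x, f y = g y) -> differentiable f x ->
  is_diff x g ('d f x).
Proof.
move=> fg df; apply: is_diff_near => [|e /(diff_near df) fe].
  exact: diff_continuous.
have fgx := nbhs_singleton fg.
by apply: filterS2 fg fe => y <-; rewrite fgx.
Qed.

(* f is an immersion at y s, with L a left inverse of its differential. *)
Lemma diff_lift (R : realType) (U V W : normedModType R) (f : V -> W)
    (g : U -> W) (y : U -> V) (s : U) (L : {linear W -> V}) :
  continuous L -> differentiable f (y s) -> (forall v, L ('d f (y s) v) = v) ->
  differentiable g s -> {for s, continuous y} ->
  (\forall t \near s, f (y t) = g t) -> differentiable y s.
Proof.
move=> cL df Ldf dg cy fyg.
have [K K0 LK] := linear_lipschitz cL.
have [C C0 gC] := linear_lipschitz (diff_continuous dg).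
have fys := nbhs_singleton fyg.
(* Apply [L] to the first-order expansion of [f] at [y s], where [f \o y] agrees with [g] nearby.
   Precision [e / K] absorbs the bound [K] of [L]; the error is still measured by the increment of
   [y]. *)
have lin e : 0 < e ->
    \forall t \near s, `|y t - y s - L (g t - g s)| <= e * `|y t - y s|.
  move=> e0; have eK : 0 < e / K by rewrite divr_gt0.
  have /cy dfy := diff_near df eK.
  apply: filterS2 fyg dfy => t /= fyt; rewrite fyt fys => H.
  rewrite distrC -[X in L _ - X]Ldf -linearB (le_trans (LK _))//.
  by rewrite mulrC -ler_pdivlMr// mulrAC.
have [M M0 yM] : exists2 M, 0 < M & \forall t \near s, `|y t - y s| <= M * `|t - s|.
  (* [lin] at precision 1/2 allows half of the increment of [y] to be absorbed on the left, whence
     the factor 2; [C + 1] bounds the increment of [g], and [K] comes from [L]. *)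
  exists (2 * (K * (C + 1))).
    by rewrite !mulr_gt0// addr_gt0.
  have lin2 := lin 2^-1 ltac:(by rewrite invr_gt0).
  apply: filterS2 (diff_near dg ltr01) lin2 => t gt yt.
  have gts : `|g t - g s| <= (C + 1) * `|t - s|.
    rewrite mulrDl -(subrK ('d g s (t - s)) (g t - g s)) (le_trans (ler_normD _ _))//.
    by rewrite addrC lerD.
  have : `|y t - y s| <= `|L (g t - g s)| + 2^-1 * `|y t - y s|.
    rewrite -[X in `|X| <= _](subrK (L (g t - g s))) (le_trans (ler_normD _ _))//.
    by rewrite addrC lerD.
  have : `|L (g t - g s)| <= K * ((C + 1) * `|t - s|).
    by rewrite (le_trans (LK _))// ler_wpM2l// ltW.
  move=> a b; rewrite -!mulrA; move: a b.
  move: `|y t - y s| (K * _) `|L _| => p q r; lra.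
pose dy : {linear U -> V} := GRing.Linear.clone _ _ _ _ (L \o 'd g s) _.
apply: (@ex_diff _ _ _ _ _ _ _ (is_diff_near (df := dy) _ _)).
  by move=> x; apply: continuous_comp; [exact: diff_continuous | exact: cL].
move=> e e0.
(* The error splits into that of [lin], which [yM] makes a multiple of [|t - s|], and the remainder
   of [g] seen through [L]; each gets [e / 2]. *)
have e2M : 0 < e / 2 / M by rewrite !divr_gt0.
have e2K : 0 < e / 2 / K by rewrite !divr_gt0.
apply: filterS3 yM (diff_near dg e2K) (lin _ e2M) => t yM gt yt.
have -> : y t - y s - dy (t - s) =
    (y t - y s - L (g t - g s)) + L (g t - g s - 'd g s (t - s)).
  by rewrite /dy /= (linearB L (g t - g s)) addrA subrK.
rewrite (le_trans (ler_normD _ _))// [e]splitr mulrDl lerD//.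
  rewrite (le_trans yt)// -[X in _ <= X * _](divfK (lt0r_neq0 M0)) -[leRHS]mulrA.
  by rewrite ler_wpM2l// ltW.
rewrite (le_trans (LK _))// -[X in _ <= X * _](divfK (lt0r_neq0 K0)).
by rewrite [_ * K]mulrC -[leRHS]mulrA ler_wpM2l// ltW.
Qed.

Lemma linear_rV_continuous (R : realType) m (V : normedModType R)
    (f : {linear 'rV[R]_m -> V}) : continuous f.
Proof.
have -> : (f : _ -> _) = \sum_(i < m) (fun v : 'rV[R]_m => v 0 i *: f 'e_i).
  apply/funext => v; rewrite fct_sumE [in LHS](row_sum_delta v) linear_sum.
  by apply: eq_bigr => i _; rewrite linearZZ.
elim/big_ind: _ => [|g h cg ch|i _] v; first exact: (@cst_continuous _ _ 0).
- exact: cvgD (cg v) (ch v).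
- by apply: continuousZr_tmp; exact: coord_continuous.
Qed.

(** The differential is picked by [xget], whose default here is the zero map. *)
Lemma diff_default (R : realType) (V W : normedModType R) (f : V -> W) (x : V) :
  ~ differentiable f x -> forall v, 'd f x v = 0.
Proof.
move=> ndf v; rewrite /diff; set P := (X in xget _ X).
case: xgetP => // df _ Pdf; case: ndf; apply/diffP.
exact: (@getPex _ P (ex_intro P df Pdf)).
Qed.

(** * Differential calculus on manifolds *)

Section Manifolds.
Context {R : realType}.

Lemma near_chartV m (M : manifold R m) (x : M) (A : set M) :
  nbhs x A -> \forall v \near chart x x, A (chartV x v).
Proof.
move=> xA; have cxx := cdom_center x.
by apply: (chartV_cont cxx); rewrite chartK.
Qed.

Lemma chart_factor m n (M : manifold R m) (N : manifold R n) (Z : Type)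
    (f : M -> N) (h : N -> Z) (x : M) : (\forall y \near x, cdom (f x) (f y)) ->
  \forall v \near chart x x,
    (h \o chartV (f x)) ((chart (f x) \o f \o chartV x) v)
    = (h \o f \o chartV x) v.
Proof. by move=> /near_chartV; apply: filterS => v /= c; rewrite chartK. Qed.

Lemma near_cdom m n (M : manifold R m) (N : manifold R n) (f : M -> N) (x : M) :
  {for x, continuous f} -> \forall y \near x, cdom (f x) (f y).
Proof.
by apply; apply: open_nbhs_nbhs; split; [exact: cdom_open|exact: cdom_center].
Qed.

Lemma differentiable_fun m (M : manifold R m) (V : normedModType R)
    (f : M -> V) (x : M) : smooth_fun_at f x ->
  differentiable (f \o chartV x) (chart x x).
Proof. by move=> /(_ 1%N) [/nbhs_singleton]. Qed.

(** First-order differentiability is all that the chain rule needs, and it is what lifting through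
    an embedding yields. Continuity is a separate clause because a chart says nothing outside its
    domain. *)
Definition mdifferentiable m n (M : manifold R m) (N : manifold R n)
    (f : M -> N) (x : M) : Prop :=
  {for x, continuous f} /\
  differentiable (chart (f x) \o f \o chartV x) (chart x x).

Lemma smooth_mdifferentiable m n (M : manifold R m) (N : manifold R n)
    (f : M -> N) : smooth f -> forall x, mdifferentiable f x.
Proof. by move=> sf x; have [cf /differentiable_fun] := sf x. Qed.

Lemma tmapE m n (M : manifold R m) (N : manifold R n) (f : M -> N) (x : M) v :
  v *m tmap f x = 'd (chart (f x) \o f \o chartV x) (chart x x) v.
Proof. by rewrite /tmap /jacobian mul_rV_lin1. Qed.

Lemma chart_tmapE m n (M : manifold R m) (N : manifold R n) (f : M -> N)
  (x : M) v : v *m tmap f x = mdiff (chart (f x) \o f) x v.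
Proof. exact: tmapE. Qed.

Lemma chartVc m (M : manifold R m) (x : M) : chartV x (chart x x) = x.
Proof. exact/chartK/cdom_center. Qed.

(** The chain rule asks only that [f] stay in the chart domain at [f x], which is weaker than
    continuity: for orbits in T^*Q it can be checked on base points. *)
Lemma is_diff_mcomp m n (M : manifold R m) (N : manifold R n)
    (V : normedModType R) (f : M -> N) (h : N -> V) (x : M) :
  (\forall y \near x, cdom (f x) (f y)) ->
  differentiable (chart (f x) \o f \o chartV x) (chart x x) ->
  differentiable (h \o chartV (f x)) (chart (f x) (f x)) ->
  is_diff (chart x x) (h \o f \o chartV x)
    (fun v => mdiff h (f x) (v *m tmap f x)).
Proof.
move=> fc df dh.
have fx : (chart (f x) \o f \o chartV x) (chart x x) = chart (f x) (f x).
  by rewrite /= chartVc.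
have dh' : differentiable (h \o chartV (f x))
    ((chart (f x) \o f \o chartV x) (chart x x)) by rewrite fx.
have := near_eq_is_diff (chart_factor h fc) (differentiable_comp df dh').
rewrite diff_comp// fx; congr is_diff_def.
by apply/funext => v; rewrite tmapE.
Qed.

Lemma mdiff_comp m n (M : manifold R m) (N : manifold R n)
    (V : normedModType R) (f : M -> N) (h : N -> V) (x : M) v :
  mdifferentiable f x ->
  differentiable (h \o chartV (f x)) (chart (f x) (f x)) ->
  mdiff (h \o f) x v = mdiff h (f x) (v *m tmap f x).
Proof.
move=> [/near_cdom fc df] dh.
by rewrite {1}/mdiff (@diff_val _ _ _ _ _ _ _ (is_diff_mcomp fc df dh)).
Qed.

(** This serves twice: [H] is constant along orbits, and [J] along the inclusion of its level. *)
Lemma mdiff_comp_const m n (M : manifold R m) (N : manifold R n)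
    (V : normedModType R) (f : M -> N) (h : N -> V) (x : M) (a : V) v :
  (\forall y \near x, cdom (f x) (f y)) ->
  differentiable (h \o chartV (f x)) (chart (f x) (f x)) ->
  (forall y, h (f y) = a) -> mdiff h (f x) (v *m tmap f x) = 0.
Proof.
move=> fc dh hfa.
(* If f is not differentiable at x then tmap f x is the junk value 0; this
   spares proving that the orbit maps of the cotangent lift are smooth. *)
have [df|ndf] :=
    pselect (differentiable (chart (f x) \o f \o chartV x) (chart x x)).
  have := @diff_val _ _ _ _ _ _ _ (is_diff_mcomp fc df dh).
  have -> : h \o f \o chartV x = cst a by apply/funext => w; exact: hfa.
  by rewrite diff_cst => /(congr1 (@^~ v)) /= <-.
suff -> : v *m tmap f x = 0 by rewrite /mdiff linear0.
by rewrite tmapE diff_default.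
Qed.

Lemma mdifferentiable_comp m n p (M : manifold R m) (N : manifold R n)
    (P : manifold R p) (f : M -> N) (g : N -> P) (x : M) :
  mdifferentiable f x -> mdifferentiable g (f x) -> mdifferentiable (g \o f) x.
Proof.
move=> [cf df] [cg dg]; split; first exact: continuous_comp.
exact: (@ex_diff _ _ _ _ _ _ _ (is_diff_mcomp (near_cdom cf) df dg)).
Qed.

Lemma tmap_comp m n p (M : manifold R m) (N : manifold R n)
    (P : manifold R p) (f : M -> N) (g : N -> P) (x : M) :
  mdifferentiable f x -> mdifferentiable g (f x) ->
  tmap (g \o f) x = tmap f x *m tmap g (f x).
Proof.
move=> df [_ dg]; apply/row_matrixP => i.
rewrite !rowE mulmxA [LHS]chart_tmapE [RHS]chart_tmapE.
exact: (mdiff_comp (h := chart (g (f x)) \o g) _ df dg).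
Qed.

Lemma tmap_id m (M : manifold R m) (x : M) : tmap id x = 1%:M.
Proof.
have E : \forall v \near chart x x, id v = (chart x \o id \o chartV x) v.
  have : nbhs (chart x x) (chart x @` cdom x).
    apply: open_nbhs_nbhs; split; first exact: cimage_open.
    by exists x => //; exact: cdom_center.
  by apply: filterS => _ [y xy <-] /=; rewrite chartK.
apply/row_matrixP => i; rewrite !rowE tmapE.
have did : differentiable (id : 'rV[R]_m -> 'rV[R]_m) (chart x x).
  exact: (@ex_diff _ _ _ _ _ _ _ (is_diff_id _)).
rewrite (@diff_val _ _ _ _ _ _ _ (near_eq_is_diff E did)) mulmx1.
by rewrite (@diff_val _ _ _ _ _ _ _ (is_diff_id _)).
Qed.

(** Continuity comes from the induced topology, differentiability from [diff_lift], as [j] is an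
    immersion in charts. *)
Lemma mdifferentiable_lift m n p (X : manifold R m) (S : manifold R n)
    (M : manifold R p) (j : S -> M) (f : X -> S) (x : X) :
  embedding j -> mdifferentiable (j \o f) x -> mdifferentiable f x.
Proof.
move=> [sj fj _ oj] djf.
have cf : {for x, continuous f}.
  move=> A; rewrite nbhsE /= => -[U [oU Ufx] UA].
  have [V oV UV] := oj U oU.
  have jV : nbhs (j (f x)) V.
    by apply: open_nbhs_nbhs; split => //; move: Ufx; rewrite UV.
  have xV : nbhs x ((j \o f) @^-1` V) := djf.1 V jV.
  suff : nbhs x (f @^-1` A) by [].
  by apply: filterS xV => y /= Vy; apply: UA; rewrite UV.
split => //.
have [cj dj] := smooth_mdifferentiable sj (f x).
have fx : (chart (f x) \o f \o chartV x) (chart x x) = chart (f x) (f x).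
  by rewrite /= chartVc.
(* The rows of [tmap j (f x)] are independent, so multiplying by the pseudo-inverse on the right
   undoes the differential of [j]. *)
pose L := mulmxr (pinvmx (tmap j (f x))) : {linear 'rV[R]_p -> 'rV[R]_n}.
apply: (@diff_lift R _ _ _ (chart (j (f x)) \o j \o chartV (f x)) _ _ _ L).
- exact: linear_rV_continuous.
- by rewrite fx.
- move=> v; rewrite fx -tmapE /L /= -mulmxA mulmxVp ?mulmx1//.
- exact: djf.2.
- apply: continuous_comp; first exact: chartV_cont (cdom_center _).
  rewrite chartVc; apply: continuous_comp; first exact: cf.
  exact: chart_cont (cdom_center _).
- exact: chart_factor (near_cdom cf).
Qed.

End Manifolds.

(** * Bilinear forms and their Gram matrices *)

Section Bilinear.
Context {R : realType}.

Lemma dot_eq0 n (u : 'rV[R]_n) :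
  (forall w : 'rV[R]_n, (u *m w^T) 0 0 = 0) -> u = 0.
Proof.
move=> u0; apply/rowP => j; rewrite [RHS]mxE -[RHS](u0 'e_j) trmx_delta -colE.
by rewrite mxE.
Qed.

Lemma bil_inj n (A : 'M[R]_n) (v v' : 'rV[R]_n) : A \in unitmx ->
  (forall w, bil A v w = bil A v' w) -> v = v'.
Proof.
move=> Au vv'; apply/eqP; rewrite -subr_eq0; apply/eqP.
rewrite -[LHS](mulmxK Au) (_ : _ *m A = 0) ?mul0mx//.
apply: dot_eq0 => w; have := vv' w; rewrite /bil => E.
by rewrite !mulmxBl mxE E [X in _ + X]mxE subrr.
Qed.

Lemma bil_pullback m n (T : 'M[R]_(m, n)) (A : 'M[R]_n) v w :
  bil (T *m A *m T^T) v w = bil A (v *m T) (w *m T).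
Proof. by rewrite /bil trmx_mul !mulmxA. Qed.

Lemma bil_skew n (A : 'M[R]_n) v w : A^T = - A -> bil A v w = - bil A w v.
Proof.
move=> AT; rewrite /bil -[v *m A *m w^T]trmxK mxE !trmx_mul trmxK AT.
by rewrite mulmxA mulmxN mulNmx [LHS]mxE.
Qed.

Lemma pairing_eq0 n (a : 'rV[R]_n) : (forall xi, pairing a xi = 0) -> a = 0.
Proof.
move=> a0; apply: dot_eq0 => w; rewrite -(a0 w) /pairing.
by rewrite -[a *m w^T]trmxK mxE trmx_mul trmxK.
Qed.

End Bilinear.

(** * Hamiltonian vector fields and symplectic reduction *)

Section Reduction.
Context {R : realType} {n k : nat} {Q : manifold R n}.
Variables (TQ : cotangent_bundle Q) (G : lie_group R k) (act : G -> Q -> Q).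
Variables (J : TQ -> 'rV[R]_k) (H : TQ -> R^o) (XH : TQ -> 'rV[R]_(n + n)).
Hypotheses (sact : smooth_action act) (mJ : momentum_map act J).
Hypothesis sH : smooth_fun H.
Hypothesis hXH : hamiltonian_vf (canonical_form TQ) H XH.

Lemma cotangent_lift_one (z : TQ) : cotangent_lift act (gone G) z = z.
Proof.
have [_ act1 _] := sact.
have V1 : ginv (gone G) = gone G by rewrite -[LHS]g1mul gmulV.
have actid : act (gone G) = id by apply/funext.
by rewrite /cotangent_lift V1 actid tmap_id trmx1 mulmx1 covecK.
Qed.

(** Pair dJ(X_H) with [xi]: by the momentum map identity and skewness this is -dH on the generator
    of [xi], which vanishes because [H] is constant along orbits. *)
Lemma momentum_conserved (z : TQ) :
  (forall g (z : TQ), H (cotangent_lift act g z) = H z) ->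
  symplectic_form (canonical_form TQ) -> mdiff J z (XH z) = 0.
Proof.
move=> Hinv [_ skew _ _]; apply: pairing_eq0 => xi.
have [_ Jham _] := mJ; rewrite -Jham bil_skew// hXH.
have orb := cotangent_lift_one z.
have := @mdiff_comp_const R _ _ G TQ R^o (fun g => cotangent_lift act g z) H
  (gone G) (H z) xi.
rewrite orb => ->; rewrite ?oppr0//; last exact: differentiable_fun.
(* Chart domains of T^*Q depend on base points only, so continuity of the action on [Q] keeps the
   orbit in the chart domain near the unit. *)
have [s2 act1 _] := sact; have [ca _] := s2 (gone G) (cbase TQ z).
have cg : {for gone G, continuous (fun g => act g (cbase TQ z))}.
  apply: (@continuous_comp _ _ _ (fun g => (g, cbase TQ z))
           (fun a : G * Q => act a.1 a.2)); last exact: ca.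
  by apply: cvg_pair; [exact: cvg_id|exact: cvg_cst].
have := near_cdom cg; apply: filterS => g.
by rewrite act1 cdom_cotangent cbase_covec.
Qed.

Variables (mu : 'rV[R]_k) (red : point_reduction act J mu).
Local Notation P := (level red).
Local Notation i := (level_incl red).
Local Notation pi := (red_proj red).

Lemma level_inclJ (p : P) : J (i p) = mu.
Proof.
have : range i (i p) by exists p.
by rewrite range_level_incl.
Qed.

(** The image of T i lies in ker dJ since [J] is constant on the level, and at a regular value both
    have dimension n + n - k. *)
Lemma level_tangent p v : regular_value J mu -> mdiff J (i p) v = 0 ->
  exists s, s *m tmap i p = v.
Proof.
move=> reg Jv.
have [sJ _ _] := mJ; have [si fi _ _] := level_incl_embedding red.
pose D := 'J (J \o chartV (i p)) (chart (i p) (i p)).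
have DE w : w *m D = mdiff J (i p) w by rewrite /D /jacobian mul_rV_lin1.
have iD : (tmap i p <= kermx D)%MS.
  apply/sub_kermxP/row_matrixP => r; rewrite rowE mulmxA DE row0.
  apply: (@mdiff_comp_const R _ _ P TQ _ i J p mu).
  - exact: near_cdom (smooth_mdifferentiable si p).1.
  - exact: differentiable_fun.
  - exact: level_inclJ.
have fD : row_full D.
  rewrite -sub1mx; apply/row_subP => r.
  have [w <-] := reg _ (level_inclJ p) (row r 1%:M).
  by rewrite -DE submxMl.
have kD : (kermx D <= tmap i p)%MS.
  by rewrite -(geq_leqif (mxrank_leqif_sup iD)) mxrank_ker (eqP fD) (eqP (fi p)).
have vD : (v <= kermx D)%MS by apply/sub_kermxP; rewrite DE.
by have /submxP[s ->] := submx_trans vD kD; exists s.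
Qed.

(** T pi is onto, so both vectors can be tested against T pi w'. By the pullback identity for the
    reduced form and h_mu o pi = H o i, both pairings equal d(H o i) w'; nondegeneracy concludes. *)
Lemma reduced_hamiltonian_vf (hmu : reduced red -> R^o) Xhmu p s :
  symplectic_form (red_form red) -> smooth_fun hmu ->
  (forall p, hmu (pi p) = H (i p)) ->
  hamiltonian_vf (red_form red) hmu Xhmu ->
  s *m tmap i p = XH (i p) -> s *m tmap pi p = Xhmu (pi p).
Proof.
move=> [_ _ wu _] sh hpi hX sE.
have [si _ _ _] := level_incl_embedding red.
have [spi fpi _] := red_proj_submersion red.
apply: (bil_inj (wu (pi p))) => w.
have /submxP[w' ->] : (w <= tmap pi p)%MS by exact/submx_full/fpi.
rewrite -bil_pullback hX.
rewrite -/(pullback_form2 pi (red_form red) p) red_form_pullback.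
rewrite bil_pullback sE hXH.
rewrite -(mdiff_comp _ (smooth_mdifferentiable si p)); last first.
  exact: differentiable_fun.
rewrite -(mdiff_comp _ (smooth_mdifferentiable spi p)); last first.
  exact: differentiable_fun.
by congr (mdiff _ p w'); apply/funext => y /=; rewrite hpi.
Qed.

Variables (eps : TQ -> TQ) (Xheps : TQ -> 'rV[R]_(n + n)).
Hypothesis symp : symplectic_form (canonical_form TQ).
Hypothesis seps : symplectic_map (canonical_form TQ) eps.
Hypothesis hXheps : hamiltonian_vf (canonical_form TQ) (H \o eps) Xheps.

(** The product of matrices expressing the pullback equals the invertible [canonical_form], so its
    factor [tmap eps z] is invertible. *)
Lemma symplectic_map_unitmx z : tmap eps z \in unitmx.
Proof.
have [_ _ wu _] := symp; have := wu z.
by rewrite -(seps.2 z) !unitmx_mul => /andP[/andP[]].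
Qed.

(** Paired with T eps w', both sides give d(H o eps) w', the left one because [eps] preserves the
    form. As T eps is onto, these vectors suffice. *)
Lemma symplectic_map_hamiltonian_vf z : Xheps z *m tmap eps z = XH (eps z).
Proof.
have [_ _ wu _] := symp.
apply: (bil_inj (wu (eps z))) => w.
have /submxP[w' ->] : (w <= tmap eps z)%MS.
  by apply/submx_full; rewrite row_full_unit symplectic_map_unitmx.
rewrite -bil_pullback -/(pullback_form2 eps (canonical_form TQ) z) (seps.2 z).
apply: (etrans (hXheps z w')); apply: (etrans _ (esym (hXH (eps z) _))).
apply: (mdiff_comp w' (smooth_mdifferentiable seps.1 z)).
exact: differentiable_fun.
Qed.

End Reduction.

Theorem theorem4p3 (R : realType) (n k : nat) (Q : manifold R n)
    (TQ : cotangent_bundle Q) (G : lie_group R k) (act : G -> Q -> Q)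
    (J : TQ -> 'rV[R]_k) (mu : 'rV[R]_k) (red : point_reduction act J mu)
    (b : nat) (B : manifold R b) (rho : reduced red -> B)
    (H : TQ -> R^o) (F : TQ -> TQ) (W : set TQ)
    (hmu : reduced red -> R^o) (fmu : reduced red -> reduced red)
    (gE : TQ -> 'M[R]_(n + n))
    (gM : reduced red -> 'M[R]_(red_dim red))
    (u : TQ -> TQ) (umu : reduced red -> reduced red)
    (Xt : TQ -> 'rV[R]_(n + n))
    (Xmu Xhmu : reduced red -> 'rV[R]_(red_dim red))
    (gamma : Q -> TQ) (eps : TQ -> TQ)
    (Xheps : TQ -> 'rV[R]_(n + n))
    (gammabar : Q -> reduced red)
    (lambdabar epsbar : level red -> reduced red) :
  regular_point_reducible rho H F W hmu fmu ->
  riemannian_metric gE -> fiberwise_euclidean gE -> riemannian_metric gM ->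
  (* the dynamical vector field and its R_p-reduction *)
  control_law (cbase TQ) W u ->
  dynamical_vf (cbase TQ) gE (canonical_form TQ) H F u Xt ->
  control_law rho (red_proj red @` (level_incl red @^-1` W)) umu ->
  dynamical_vf rho gM (red_form red) hmu fmu umu Xmu ->
  (forall p, tangent_image (level_incl red) (red_proj red) p
               (Xt (level_incl red p)) (Xmu (red_proj red p))) ->
  one_form gamma ->
  (forall q, J (gamma q) = mu) ->
  (forall g q, coadjoint_isotropy mu g ->
     gamma (act g q) = cotangent_lift act g (gamma q)) ->
  symplectic_map (canonical_form TQ) eps ->
  (forall g z, coadjoint_isotropy mu g ->
     eps (cotangent_lift act g z) = cotangent_lift act g (eps z)) ->
  (forall z, J z = mu -> J (eps z) = mu) ->
  (* gammabar = pi_mu o gamma, lambdabar = pi_mu o lambda, epsbar = pi_mu o eps *)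
  reduces_to (level_incl red) (red_proj red) gamma gammabar ->
  reduces_to (level_incl red) (red_proj red)
    (gamma \o cbase TQ \o level_incl red) lambdabar ->
  reduces_to (level_incl red) (red_proj red) (eps \o level_incl red) epsbar ->
  (* the Hamiltonian vector fields of h_mu and of h_mu o epsbar *)
  hamiltonian_vf (red_form red) hmu Xhmu ->
  hamiltonian_vf (canonical_form TQ) (H \o eps) Xheps ->
  (* T epsbar o X_(h_mu o epsbar) = T lambdabar o Xt o eps *)
  (forall p : level red, exists p' w,
     [/\ level_incl red p' = eps (level_incl red p),
         tangent_image (level_incl red) epsbar p (Xheps (level_incl red p)) w &
         tangent_image (level_incl red) lambdabar p'
           (Xt (eps (level_incl red p))) w])
  <->
  (* T gammabar o (T pi_Q o Xt o eps) = X_(h_mu) o epsbar *)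
  (forall p : level red,
     let z := eps (level_incl red p) in
     (Xt z *m tmap (cbase TQ) z) *m tmap gammabar (cbase TQ z)
     = Xhmu (epsbar p)).
Proof.
move=> rpr _ _ _ _ [XH [_ [_ [hXH _ _ _]]]] _ _ tXt [sg _] gJ _ seps _.
move=> epsJ hgb hlb heb hXhmu hXheps.
case: rpr => [[sact _ _] mJ reg rch Hinv _ _ _ _ hpi _ rred].
have [[[scb _ _] symp] sH _ _] := rch.
have [[_ sympr] sh _ _] := rred.
have emb := level_incl_embedding red.
have [si fi inji _] := emb.
have [spi fpi _] := red_proj_submersion red.
have mi := smooth_mdifferentiable si.
have mpi := smooth_mdifferentiable spi.
(* J^-1(mu) is a manifold of its own with an inclusion, so maps into it are lifted by choice; their
   differentiability is recovered from [mdifferentiable_lift]. *)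
have lift (X : Type) (f : X -> TQ) : (forall x, J (f x) = mu) ->
    exists ft : X -> level red, level_incl red \o ft = f.
  move=> fJ; have /choice[ft ftE] : forall x, exists p, level_incl red p = f x.
    move=> x; have : [set z | J z = mu] (f x) by exact: fJ.
    by rewrite -(range_level_incl red) => -[p _ pE]; exists p.
  by exists ft; apply/funext.
have [et etE] := lift _ (eps \o level_incl red)
  (fun p => epsJ _ (level_inclJ p)).
have [gt gtE] := lift _ gamma gJ.
have etp p : level_incl red (et p) = eps (level_incl red p).
  exact: (congr1 (@^~ p) etE).
have ebE : epsbar = red_proj red \o et by apply/funext => p; exact: heb.
have gbE : gammabar = red_proj red \o gt.
  by apply/funext => q; apply: hgb; exact: (congr1 (@^~ q) gtE).
have lbE : lambdabar = gammabar \o (cbase TQ \o level_incl red).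
  apply/funext => p; rewrite gbE; apply: hlb.
  exact: (congr1 (@^~ _) gtE).
have meps := smooth_mdifferentiable seps.1.
have mei p : mdifferentiable (eps \o level_incl red) p.
  by apply: mdifferentiable_comp.
have met p : mdifferentiable et p.
  by apply: (mdifferentiable_lift emb); rewrite etE.
have mgt q : mdifferentiable gt q.
  by apply: (mdifferentiable_lift emb); rewrite gtE; exact: smooth_mdifferentiable.
have mgb q : mdifferentiable gammabar q.
  by rewrite gbE; exact: mdifferentiable_comp.
have mcb := smooth_mdifferentiable scb.
have mci p : mdifferentiable (cbase TQ \o level_incl red) p.
  by apply: mdifferentiable_comp.
have lbT p s : s *m tmap lambdabar p
    = s *m tmap (level_incl red) p *m tmap (cbase TQ) (level_incl red p)
      *m tmap gammabar (cbase TQ (level_incl red p)).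
  by rewrite lbE tmap_comp// tmap_comp// !mulmxA.
have etT p : tmap et p *m tmap (level_incl red) (et p)
    = tmap (level_incl red) p *m tmap eps (level_incl red p).
  have := tmap_comp (met p) (mi (et p)); rewrite etE => <-.
  exact: tmap_comp (mi p) (meps _).
have epsu := symplectic_map_unitmx symp seps.
(* By [etT] the rank of T et is at least that of T i followed by the invertible T eps, which is the
   full dimension of the level. *)
have etu p : tmap et p \in unitmx.
  rewrite -row_free_unit -row_leq_rank -[leqLHS](eqP (fi p)).
  have epsf : row_free (tmap eps (level_incl red p)).
    by rewrite row_free_unit epsu.
  by rewrite -(mxrankMfree _ epsf) -etT mxrankM_maxl.
have key p : exists2 t, t *m tmap (level_incl red) p = Xheps (level_incl red p)
    & t *m tmap epsbar p = Xhmu (epsbar p).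
  have [s sE] := level_tangent mJ reg
    (momentum_conserved sact mJ sH hXH (level_incl red (et p)) Hinv symp).
  (* The lift of X_H at [et p] is pulled back by T et. That T i sends it to X_(H o eps) is checked
     after applying T eps, which cancels. *)
  exists (s *m invmx (tmap et p)).
    apply: (can_inj (mulmxK (epsu (level_incl red p)))).
    rewrite (symplectic_map_hamiltonian_vf sH hXH symp seps hXheps).
    by rewrite /= -(mulmxA (s *m _)) -etT mulmxA mulmxKV// sE etp.
  rewrite ebE tmap_comp// mulmxA mulmxKV//.
  exact: (reduced_hamiltonian_vf sH hXH sympr sh hpi hXhmu sE).
split=> [eq1 p|eq2 p] /=.
  have [p' [w [p'E [t tE tw] [t' t'E t'w]]]] := eq1 p.
  have [t0 t0E <-] := key p.
  (* T i is injective, so the vector in the equation is the one from [key]. By [lbT], the other side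
     depends on [p'] only through its image in T^*Q. *)
  have -> : t0 = t by apply: (row_free_inj (fi p)); rewrite t0E tE.
  by rewrite tw -t'w lbT t'E p'E.
have [t tE tw] := key p.
(* The reduction condition makes [Xt] tangent to the level at [et p], so that T lambdabar applies to
   it. *)
have [t' t'E _] := tXt (et p).
exists (et p), (Xhmu (epsbar p)).
split; [exact: etp|by exists t|exists t'; first by rewrite t'E etp].
by rewrite lbT t'E etp -eq2.
Qed.
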